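(* For a vector configuration $U$ with Gale dual $U^*$ the following are equivalent: \begin{enumerate} \item $U^*$ satisfies the Lonely Vector Property. \item Some deletion $U_\mathbf{u}$ or diagonal $U_{\mathbf{u}, \mathbf{v}}^{\pm}$ of $U$ is cosimple. \end{enumerate}
   Context: A vector configuration is a finite labeled multiset of vectors. An integer configuration $U\subset\mathbb Z^d$ of rank $d$ and size $n$ is cosimple if there is a linear dependence $\sum_{\mathbf{u}\in U}\lambda_\mathbf{u}\mathbf{u}=0$ with all $\lambda_\mathbf{u}\neq 0$ and $|\lambda_\mathbf{u}|\neq|\lambda_\mathbf{v}|$ for all distinct $\mathbf{u},\mathbf{v}\in U$. A Gale dual $U^*$ of $U$ is a configuration of size $n$ and rank $n-d$ (with elements labeled as those of $U$) such that the coefficient vectors of linear dependences of $U$ are exactly the vectors of values of linear functionals on $U^*$, and vice versa. The deletion of $\mathbf{u}\in U$ is $U_\mathbf{u}:=U\setminus\{\mathbf{u}\}$; the positive and negative diagonals at $\mathbf{u},\mathbf{v}\in U$ are $U^+_{\mathbf{u},\mathbf{v}}:=U\setminus\{\mathbf{u},\mathbf{v}\}\cup\{\mathbf{u}+\mathbf{v}\}$ and $U^-_{\mathbf{u},\mathbf{v}}:=U\setminus\{\mathbf{u},\mathbf{v}\}\cup\{\mathbf{u}-\mathbf{v}\}$. For a vector configuration $S$, let $D(S)$ be the multiset (of $|S|^2$ elements) containing $2\mathbf{u}$ for each $\mathbf{u}\in S$ and, for each unordered pair $\{\mathbf{u},\mathbf{v}\}$ of distinct elements of $S$, the vector $\mathbf{u}+\mathbf{v}$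 and one of $\mathbf{u}-\mathbf{v}$, $\mathbf{v}-\mathbf{u}$. A configuration $S$ has the Lonely Vector Property if $D(S)$ contains an element that is not proportional to any other element of $D(S)$.
   Formalization: The case of a single nonzero vector in rank 1 (n = d = 1) is excluded: there U* = {0} satisfies the Lonely Vector Property vacuously, but the only deletion is empty, of rank 0, hence not cosimple. *)

(* Defs.v *)
From HB Require Import structures.
From mathcomp Require Import all_boot all_order all_algebra.

Set Implicit Arguments.
Unset Strict Implicit.
Unset Printing Implicit Defensive.

Import Order.TTheory GRing.Theory Num.Theory.
Local Open Scope ring_scope.

(* A vector configuration is a family of vectors indexed by a finite type of
   labels, so that repeated and zero vectors are allowed. *)

Section Configurations.

Variables (R : realFieldType) (E : vectType R).

Definition config_rank (I : finType) (S : I -> E) : nat :=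
  \dim <<[seq S i | i : I]>>.

Definition dependence (I : finType) (S : I -> E) (lam : I -> R) : Prop :=
  \sum_(i : I) lam i *: S i = 0.

Definition functional_values (I : finType) (S : I -> E) (lam : I -> R) : Prop :=
  exists f : {scalar E}, forall i, lam i = f (S i).

(* The zero vector is proportional to every vector. *)
Definition proportional (x y : E) : Prop :=
  (exists c : R, x = c *: y) \/ (exists c : R, y = c *: x).

(* The n ^ 2 ordered pairs label the multiset D(S): the diagonal gives the
   doubled vectors; of the two orderings of an unordered pair, the increasing
   one gives the sum and the decreasing one gives the difference. *)
Definition Dconfig (n : nat) (S : 'I_n -> E) (p : 'I_n * 'I_n) : E :=
  if p.1 == p.2 then S p.1 *+ 2
  else if (p.1 < p.2)%N then S p.1 + S p.2
  else S p.1 - S p.2.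

(* "Other" means another label: equal vectors with different labels are
   different elements of the multiset. *)
Definition lonely_vector_property (n : nat) (S : 'I_n -> E) : Prop :=
  exists p, forall q, q != p -> ~ proportional (Dconfig S p) (Dconfig S q).

End Configurations.

Definition gale_dual (R : realFieldType) (E F : vectType R) (I : finType)
    (U : I -> E) (V : I -> F) : Prop :=
  [/\ config_rank V = (#|I| - config_rank U)%N,
      forall lam : I -> R, dependence U lam <-> functional_values V lam
    & forall lam : I -> R, dependence V lam <-> functional_values U lam].

Section IntegerConfigurations.

Variables (d : nat) (I : finType).
Implicit Types U : I -> 'rV[int]_d.

Definition scalar_ext (R : realFieldType) U (i : I) : 'rV[R]_d :=
  map_mx intr (U i).

(* Full rank d in Z^d is part of the notion: deleting u with u^* = 0, or taking
   the positive (negative) diagonal at u, v with u^* = v^* (u^* = - v^* ), drops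
   the rank, and the result is then not cosimple. *)
Definition cosimple (R : realFieldType) U : Prop :=
  config_rank (scalar_ext R U) = d /\
  exists lam : I -> R,
    [/\ dependence (scalar_ext R U) lam,
        forall i, lam i != 0
      & forall i j, i != j -> `|lam i| != `|lam j|].

Definition deletion U (u : I) (i : {i : I | i != u}) : 'rV[int]_d :=
  U (val i).

(* The label None carries the new vector. *)
Definition pos_diagonal U (u v : I)
    (i : option {i : I | (i != u) && (i != v)}) : 'rV[int]_d :=
  if i is Some j then U (val j) else U u + U v.

Definition neg_diagonal U (u v : I)
    (i : option {i : I | (i != u) && (i != v)}) : 'rV[int]_d :=
  if i is Some j then U (val j) else U u - U v.

End IntegerConfigurations.

Arguments deletion {d I} U u i.
Arguments pos_diagonal {d I} U u v i.
Arguments neg_diagonal {d I} U u v i.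

(* Main.v *)
(* Write V for the Gale dual. The dependences of U are the value vectors of the
   functionals on V, so the dependences of the deletion at u, resp. of the
   diagonal at u, v, are the functionals on V that vanish at V u, resp. at
   V u - V v or V u + V v; these vectors are, up to a nonzero scalar, elements of
   D(V). The dependence has nonzero coefficients with distinct absolute values
   iff the functional is nonzero at all other elements of D(V). As the field is
   infinite, such a functional exists iff no other element lies on the line of
   the given one; and the minor has full rank iff the given one is nonzero. *)
Require Import Defs.
From HB Require Import structures.
From mathcomp Require Import all_boot all_order all_algebra.
From mathcomp Require Import lra ring.
Set Implicit Arguments.
Unset Strict Implicit.
Unset Printing Implicit Defensive.
Import Order.TTheory GRing.Theory Num.Theory.
Local Open Scope ring_scope.

(** * Linear functionals and spans *)

(** The residue [x - projv W x] is nonzero, so one of its coordinates is; that coordinate of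
    [v - projv W v] is linear in [v] and kills [W]. *)
Lemma separating_functional (K : fieldType) (E : vectType K) (W : {vspace E})
    (x : E) :
  x \notin W -> exists2 f : {scalar E}, {in W, forall w, f w = 0} & f x != 0.
Proof.
move=> xW.
pose h i (v : E) : K := coord (vbasis {:E}) i (v - projv W v).
have h_lin i : scalar (h i).
  by move=> a u v; rewrite /h /= !linearB /= !linearP /=; ring.
pose f i : {scalar E} := HB.pack (h i) (GRing.isLinear.Build _ _ _ _ _ (h_lin i)).
have f0 i w : w \in W -> f i w = 0.
  by move=> /projv_id; rewrite /= /h /= => ->; rewrite subrr linear0.
have [i fi|nf] := pickP (fun i => f i x != 0).
  by exists (f i) => // w; apply: f0.
case/negP: xW; have /subr0_eq -> : x - projv W x = 0; last exact: memv_proj.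
rewrite (coord_vbasis (memvf (x - projv W x))) big1 // => i _.
by move/negbFE/eqP: (nf i); rewrite /= /h /= => ->; rewrite scale0r.
Qed.

(** Induction on [s]: a functional good for the tail is perturbed by a multiple of one that vanishes
    at [x] but not at the new vector [y]. *)
Lemma generic_functional (R : realFieldType) (E : vectType R) (x : E) (s : seq E) :
  {in s, forall w, w \notin <[x]>%VS} ->
  exists2 f : {scalar E}, f x = 0 & {in s, forall w, f w != 0}.
Proof.
elim: s => [|y s IHs] sx.
  have [_|x0] := eqVneq x 0; exists (\0 : {scalar E}) => //.
have [|f fx fs] := IHs; first by move=> w ws; apply: sx; rewrite inE ws orbT.
have [g gx gy] := separating_functional (sx y (mem_head _ _)).
(* For g w <> 0 the value f w + t * g w vanishes only at t = - f w / g w. *)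
pose b w := - f w / g w.
(* This exceeds every [|b w|], so it avoids all the bad values at once. *)
pose t := 1 + \sum_(w <- y :: s) `|b w|.
have tb w : w \in y :: s -> t != b w.
  move=> ws; apply: contraTneq isT => tE.
  have: t <= \sum_(v <- y :: s) `|b v|.
    rewrite {1}tE (le_trans (ler_norm _)) // (big_rem w) //= lerDl.
    exact: sumr_ge0.
  by rewrite /t; lra.
pose h w := f w + t * g w.
have h_lin : scalar h by move=> a u v; rewrite /h !linearP /=; ring.
pose h' : {scalar E} := HB.pack h (GRing.isLinear.Build _ _ _ _ _ h_lin).
exists h'; first by rewrite /= /h fx gx ?memv_line // mulr0 addr0.
move=> w wys; rewrite /= /h.
have [g0|gn0] := eqVneq (g w) 0.
  rewrite g0 mulr0 addr0; apply: fs; move: wys; rewrite inE => /orP[/eqP wy|//].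
  by rewrite -wy g0 eqxx in gy.
apply: contra (tb w wys) => /eqP hw; apply/eqP; rewrite /b.
by apply: (mulIf gn0); rewrite divfK //; move: hw; lra.
Qed.

(** A proper subspace is killed by a nonzero functional. Rank is thus put in terms of functionals,
    which Gale duality can translate. *)
Lemma config_rankP (R : realFieldType) (d : nat) (J : finType)
    (W : J -> 'rV[R]_d) :
  config_rank W = d <->
  forall g : {scalar 'rV[R]_d}, (forall j, g (W j) = 0) -> forall x, g x = 0.
Proof.
have dimE : \dim {:'rV[R]_d} = d by rewrite dimvf /dim /= mul1n.
have Wspan j : W j \in <<[seq W i | i : J]>>%VS by apply/memv_span/image_f.
split=> [rk g gW x|gW].
  have : x \in <<[seq W i | i : J]>>%VS.
    suff -> : <<[seq W i | i : J]>>%VS = fullv by rewrite memvf.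
    apply/eqP; rewrite -(geq_leqif (dimv_leqif_eq (subvf _))) dimE.
    by rewrite -[X in (X <= _)%N]rk.
  move=> /coord_span ->; rewrite linear_sum big1 // => i _.
  rewrite linearZ /=; have /imageP[j _ ->] : [seq W j | j : J]`_i \in [seq W j | j : J].
    by rewrite mem_nth ?size_image.
  by rewrite gW mulr0.
rewrite /config_rank -[RHS]dimE; congr (\dim _); apply/eqP.
rewrite eqEsubv subvf; apply/subvP => x _; apply: contraT.
move=> /separating_functional[g g0 gx].
by rewrite gW ?eqxx // in gx => j; apply: g0.
Qed.

Lemma not_proportional_functional (R : realFieldType) (E : vectType R)
    (T : finType) (D : T -> E) (p : T) :
  (forall q, q != p -> ~ proportional (D p) (D q)) ->
  exists2 f : {scalar E}, f (D p) = 0 & forall q, q != p -> f (D q) != 0.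
Proof.
move=> Dp.
have [|f fp fq] :=
  @generic_functional _ _ (D p) [seq D q | q <- enum (predC1 p)].
  move=> y /mapP[q]; rewrite mem_enum => /Dp npq ->.
  by apply/negP => /vlineP[c Dq]; apply: npq; right; exists c.
by exists f => // q qp; apply/fq/map_f; rewrite mem_enum.
Qed.

(** If [x = c *: y], then [c * f y = 0] forces [c = 0], hence [x = 0]. *)
Lemma functional_not_proportional (R : realFieldType) (E : vectType R)
    (x y : E) (f : {scalar E}) :
  x != 0 -> f x = 0 -> f y != 0 -> ~ proportional x y.
Proof.
move=> x0 fx fy [[c xE]|[c yE]]; last by rewrite yE linearZ /= fx mulr0 eqxx in fy.
move: fx; rewrite xE linearZ /= => /eqP; rewrite mulf_eq0 (negPf fy) orbF => /eqP c0.
by rewrite xE c0 scale0r eqxx in x0.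
Qed.

(* A functional vanishing on W but not on U yields a nonzero dependence of the
   Gale dual V, which is proportional to z. *)
Lemma gale_dual_rankP (R : realFieldType) (d : nat) (E : vectType R)
    (I J : finType) (U : I -> 'rV[R]_d) (V : I -> E) (W : J -> 'rV[R]_d)
    (z : I -> R) (k : I) :
  config_rank U = d -> gale_dual U V -> z k != 0 ->
  (forall g : {scalar 'rV[R]_d},
    (forall j, g (W j) = 0) <-> exists c, forall i, g (U i) = c * z i) ->
  config_rank W = d <-> \sum_i z i *: V i != 0.
Proof.
move=> /config_rankP rkU [_ _ VU] zk Wz; split.
  move/config_rankP=> rkW; apply/negP => /eqP /VU[g gz].
  move: zk; rewrite gz rkW ?eqxx //.
  by apply/Wz; exists 1 => i; rewrite mul1r gz.
(* By duality the values [c * z i] form a dependence of [V], so [c = 0] and [g] kills [U], which has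
   full rank. *)
move=> Vz; apply/config_rankP => g /Wz[c gc]; apply: rkU => i.
have /eqP : \sum_i g (U i) *: V i = 0 by apply/VU; exists g.
under eq_bigr do rewrite gc -scalerA.
rewrite -scaler_sumr scaler_eq0 (negPf Vz) orbF gc => /eqP ->.
exact: mul0r.
Qed.

Lemma big_option (R : Type) (idx : R) (op : Monoid.com_law idx) (J : finType)
    (F : option J -> R) :
  \big[op/idx]_i F i = op (F None) (\big[op/idx]_j F (Some j)).
Proof.
rewrite (bigD1 None) //=; congr (op _ _).
rewrite (reindex_omap Some id) /=; last by case.
by apply: eq_bigl => j; rewrite eqxx.
Qed.

(** * Cosimplicity of minors in terms of the Gale dual *)

Section GaleMinors.

Variables (R : realFieldType) (d : nat) (E : vectType R) (I : finType).
Variables (U : I -> 'rV[int]_d) (V : I -> E).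
Hypothesis U_full : config_rank (scalar_ext R U) = d.
Hypothesis UV : gale_dual (scalar_ext R U) V.

Lemma deletion_dependence (u : I) (lam : I -> R) (mu : {i : I | i != u} -> R) :
  lam u = 0 -> (forall j, mu j = lam (val j)) ->
  dependence (scalar_ext R (deletion U u)) mu <-> dependence (scalar_ext R U) lam.
Proof.
move=> lu muE; rewrite /dependence [in X in _ <-> X](bigD1 u) //= lu scale0r add0r.
by rewrite (big_sub (fun i => i != u)); under eq_bigr do rewrite muE.
Qed.

(** A functional kills the deletion iff its values on [U] are supported at [u], so [z] is the
    indicator of [u]. *)
Lemma deletion_rankP (u : I) :
  config_rank (scalar_ext R (deletion U u)) = d <-> V u != 0.
Proof.
have -> : V u = \sum_i (i == u)%:R *: V i.
  rewrite (bigD1 u) //= eqxx scale1r big1 ?addr0 // => i /negPf ->.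
  exact: scale0r.
apply: (gale_dual_rankP (k := u) U_full UV); first by rewrite eqxx oner_eq0.
move=> g; split=> [g0|[c gc] j].
  exists (g (scalar_ext R U u)) => i; have [->|iu] := eqVneq; first by rewrite mulr1.
  by rewrite mulr0 -(g0 (Sub i iu)).
by have := gc (val j); rewrite (negPf (valP j)) mulr0.
Qed.

Lemma deletion_cosimpleP (u : I) :
  cosimple R (deletion U u) <->
  V u != 0 /\ exists f : {scalar E},
    [/\ f (V u) = 0, forall i, i != u -> f (V i) != 0
      & forall i j, i != u -> j != u -> i != j -> `|f (V i)| != `|f (V j)|].
Proof.
have [_ depU _] := UV.
split=> -[/deletion_rankP rk].
  case=> mu [dep nz ne]; split=> //.
  (* Extension by zero: the default is reached only at [u]. *)
  pose lam i := oapp mu 0 (insub i).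
  have lam_sub i (iu : i != u) : lam i = mu (Sub i iu) by rewrite /lam insubT.
  have lu : lam u = 0 by rewrite /lam insubN ?eqxx.
  have /depU[f fE] : dependence (scalar_ext R U) lam.
    apply/(deletion_dependence (mu := mu) lu) => // j.
    by rewrite lam_sub ?(valP j) // => ?; congr mu; apply: val_inj.
  exists f; split; first by rewrite -fE.
    by move=> i iu; rewrite -fE lam_sub.
  by move=> i j iu ju ij; rewrite -!fE !lam_sub; apply: ne.
case=> f [fu nz ne]; split=> //.
exists (fun j => f (V (val j))); split=> [|j|i j ij].
- by apply/(deletion_dependence (lam := fun i => f (V i))) => //; apply/depU; exists f.
- exact/nz/(valP j).
- by apply: ne; rewrite ?(valP i) ?(valP j).
Qed.

Section Diagonal.

(* X is the diagonal of sign e at u and v. *)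
Variables (u v : I) (e : R).
Variable X : option {i : I | (i != u) && (i != v)} -> 'rV[int]_d.
Hypotheses (uv : u != v) (ee : e * e = 1).
Hypothesis XS : forall j, scalar_ext R X (Some j) = scalar_ext R U (val j).
Hypothesis XN : scalar_ext R X None = scalar_ext R U u + e *: scalar_ext R U v.

(** The coefficient of the new vector is distributed over [u] and [v], with factor [e] at [v]. *)
Lemma diagonal_dependence (lam : I -> R) (mu : option _ -> R) :
  lam u = mu None -> lam v = e * mu None ->
  (forall j, mu (Some j) = lam (val j)) ->
  dependence (scalar_ext R X) mu <-> dependence (scalar_ext R U) lam.
Proof.
move=> lu lv muE; rewrite /dependence big_option.
rewrite [in X in _ <-> X](bigD1 u) // [in X in _ <-> X](bigD1 v) /= 1?eq_sym //.
rewrite (big_sub (fun i => (i != u) && (i != v))) XN lu lv.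
under eq_bigr do rewrite muE XS.
by rewrite scalerDr scalerA mulrC addrA.
Qed.

(** A functional kills the new vector iff its values at [u] and [v] are in ratio [1 : - e], by
    [e * e = 1]; this ratio dictates [z]. *)
Lemma diagonal_rankP :
  config_rank (scalar_ext R X) = d <-> V u - e *: V v != 0.
Proof.
have vu : v == u = false by rewrite eq_sym; apply/negbTE.
pose z i : R := (i == u)%:R - e * (i == v)%:R.
have -> : V u - e *: V v = \sum_i z i *: V i.
  rewrite (bigD1 u) // (bigD1 v) /= ?vu // big1 => [|i /andP[/negPf iu /negPf iv]].
    by rewrite /z !eqxx vu (negPf uv) mulr1 mulr0 subr0 sub0r scale1r scaleNr addr0.
  by rewrite /z iu iv mulr0 subr0 scale0r.
apply: (gale_dual_rankP (k := u) U_full UV).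
  by rewrite /z eqxx (negPf uv) mulr0 subr0 oner_eq0.
move=> g; split=> [g0|[c gc]].
  have := g0 None; rewrite XN linearD linearZ /= => guv.
  exists (g (scalar_ext R U u)) => i; rewrite /z.
  have [->|iu] := eqVneq i u; first by rewrite (negPf uv) /=; ring.
  have [->|iv] := eqVneq i v.
    have /eqP guE := guv; rewrite addrC addr_eq0 in guE.
    by rewrite -[LHS]mul1r -[in LHS]ee -mulrA (eqP guE) /=; ring.
  have iuv : (i != u) && (i != v) by rewrite iu.
  by have := g0 (Some (Sub i iuv)); rewrite XS => -> /=; ring.
case=> [j|].
  rewrite XS gc /z; have /andP[/negPf -> /negPf ->] := valP j.
  by rewrite /=; ring.
rewrite XN linearD linearZ /= !gc /z !eqxx vu (negPf uv).
have -> : c * (1 - e * 0) + e * (c * (0 - e * 1)) = c * (1 - e * e) by ring.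
by rewrite ee subrr mulr0.
Qed.

(** The coefficient at [None] reappears up to sign at both [u] and [v], so this pair alone is exempt
    from having distinct absolute values. *)
Lemma diagonal_cosimpleP :
  cosimple R X <->
  V u - e *: V v != 0 /\ exists f : {scalar E},
    [/\ f (V v) = e * f (V u), forall i, f (V i) != 0
      & forall i j, i != j -> (i, j) \notin [:: (u, v); (v, u)] ->
          `|f (V i)| != `|f (V j)|].
Proof.
have [_ depU _] := UV.
have e0 : e != 0 by apply: contra_eq_neq ee => ->; rewrite mul0r eq_sym oner_eq0.
have ne1 : `|e| = 1 by apply/eqP; rewrite -sqrp_eq1 ?normr_ge0 // expr2 -normrM ee normr1.
split=> -[/diagonal_rankP rk].
  case=> mu [dep nz ne]; split=> //.
  pose lam i := if i == u then mu None else if i == v then e * mu None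
    else oapp (mu \o Some) 0 (insub i).
  have lu : lam u = mu None by rewrite /lam eqxx.
  have lv : lam v = e * mu None by rewrite /lam eq_sym (negPf uv) eqxx.
  have lam_sub i (iuv : (i != u) && (i != v)) : lam i = mu (Some (Sub i iuv)).
    by have /andP[/negPf iu /negPf iv] := iuv; rewrite /lam iu iv insubT.
  have /depU[f fE] : dependence (scalar_ext R U) lam.
    apply/(diagonal_dependence (mu := mu) lu lv) => // j.
    by rewrite lam_sub ?(valP j) // => ?; congr (mu (Some _)); apply: val_inj.
  (* Up to sign lam is mu composed with the map sending both u and v to None. *)
  pose r i : option {i : I | (i != u) && (i != v)} := insub i.
  have lamE i : `|lam i| = `|mu (r i)|.
    rewrite /r; have [iuv|] := boolP ((i != u) && (i != v)).
      by rewrite lam_sub insubT.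
    move=> iuv; rewrite insubN //; move: iuv; rewrite negb_and !negbK.
    by case/orP=> /eqP ->; rewrite ?lu // lv normrM ne1 mul1r.
  exists f; split; first by rewrite -!fE lv lu.
    by move=> i; rewrite -fE -normr_gt0 lamE normr_gt0.
  move=> i j ij nij; rewrite -!fE !lamE; apply: ne; apply: contra nij.
  (* Distinct labels with equal images under [r] both go to [None], so they are [u] and [v] in some
     order. *)
  rewrite /r; case: insubP => [a _ ai|]; case: insubP => [b _ bj|] //.
    by case/eqP => ab; rewrite -ai -bj ab eqxx in ij.
  rewrite !negb_and !negbK => hj hi _; rewrite !inE !xpair_eqE.
  case/orP: hi ij => /eqP ->; case/orP: hj => /eqP ->; rewrite !eqxx ?orbT //.
case=> f [fvu nz ne]; split=> //.
pose mu (j : option {i : I | (i != u) && (i != v)}) :=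
  if j is Some k then f (V (val k)) else f (V u).
exists mu; split=> [|[j|]|i j].
- apply/(diagonal_dependence (lam := fun i => f (V i))) => //.
  by apply/depU; exists f.
- exact: nz.
- exact: nz.
- have notin (k : {i : I | (i != u) && (i != v)}) : `|f (V (val k))| != `|f (V u)|.
    have /andP[ku kv] := valP k.
    by apply: ne => //; rewrite !inE !xpair_eqE (negPf ku) (negPf kv).
  case: i j => [a|] [b|] //= ab; [|exact: notin|rewrite eq_sym; exact: notin].
  apply: ne => //; have /andP[/negPf au /negPf av] := valP a.
  by rewrite !inE !xpair_eqE au av.
Qed.

End Diagonal.

End GaleMinors.

(** * Functionals evaluated on [D(V)] *)

Section LonelyFunctional.

Variables (R : realFieldType) (E : vectType R) (n : nat) (V : 'I_n -> E).
Variable f : {scalar E}.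

Lemma Dconfig_diag i : Dconfig V (i, i) = V i *+ 2.
Proof. by rewrite /Dconfig eqxx. Qed.

Lemma Dconfig_lt (i j : 'I_n) : (i < j)%N -> Dconfig V (i, j) = V i + V j.
Proof. by move=> ij; rewrite /Dconfig /= -val_eqE /= ltn_eqF // ij. Qed.

Lemma Dconfig_gt (i j : 'I_n) : (j < i)%N -> Dconfig V (i, j) = V i - V j.
Proof. by move=> ji; rewrite /Dconfig /= -val_eqE /= gtn_eqF // ltnNge ltnW. Qed.

Lemma functional_Dconfig_diag i : (f (Dconfig V (i, i)) != 0) = (f (V i) != 0).
Proof. by rewrite Dconfig_diag raddfMn /= mulrn_eq0. Qed.

(** Absolute values agree iff the sum or the difference vanishes; [(i, j)] and [(j, i)] label these
    two, in an order depending on [i < j]. *)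
Lemma functional_Dconfig_offdiag i j : i != j ->
  (`|f (V i)| != `|f (V j)|) =
  (f (Dconfig V (i, j)) != 0) && (f (Dconfig V (j, i)) != 0).
Proof.
rewrite -val_eqE /= eqr_norm2 negb_or => nij.
have [ij|ji|/eqP] := ltngtP i j; last by rewrite (negPf nij).
  rewrite Dconfig_lt // Dconfig_gt // linearD linearB /= subr_eq0 addr_eq0.
  by rewrite [f (V j) == _]eq_sym andbC.
by rewrite Dconfig_gt // Dconfig_lt // linearB linearD /= subr_eq0 [f (V j) + _]addrC addr_eq0.
Qed.

(** If sum and difference both vanished, so would [f (V i)]. *)
Lemma functional_Dconfig_swap i j : i != j -> f (V i) != 0 ->
  f (Dconfig V (i, j)) = 0 -> f (Dconfig V (j, i)) != 0.
Proof.
rewrite -val_eqE /= => nij fi.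
have [ij|ji|/eqP] := ltngtP i j; last by rewrite (negPf nij).
  rewrite Dconfig_lt // Dconfig_gt // linearD linearB /= => fij.
  by apply: contra fi => /eqP fji; apply/eqP; lra.
rewrite Dconfig_gt // Dconfig_lt // linearB linearD /= => fij.
by apply: contra fi => /eqP fji; apply/eqP; lra.
Qed.

Lemma lonely_deletion u :
  V u != 0 -> f (V u) = 0 -> (forall i, i != u -> f (V i) != 0) ->
  (forall i j, i != u -> j != u -> i != j -> `|f (V i)| != `|f (V j)|) ->
  lonely_vector_property V.
Proof.
move=> Vu fu nz ne; exists (u, u) => -[i j] neq.
apply: (functional_not_proportional (f := f)).
- by rewrite Dconfig_diag -scaler_nat scaler_eq0 pnatr_eq0.
- by rewrite Dconfig_diag raddfMn /= fu mul0rn.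
have [ij|ij] := eqVneq i j.
  by rewrite -ij functional_Dconfig_diag nz //; move: neq; rewrite -ij xpair_eqE andbb.
suff : `|f (V i)| != `|f (V j)| by rewrite functional_Dconfig_offdiag // => /andP[].
(* Pairs containing [u] escape [ne], but there exactly one of the two values is zero. *)
have [iu|iu] := eqVneq i u.
  by rewrite iu fu normr0 eq_sym normr_eq0 nz // -iu eq_sym.
have [ju|ju] := eqVneq j u; first by rewrite ju fu normr0 normr_eq0 nz.
exact: ne.
Qed.

Lemma lonely_diagonal u v :
  u != v -> Dconfig V (u, v) != 0 -> f (Dconfig V (u, v)) = 0 ->
  (forall i, f (V i) != 0) ->
  (forall i j, i != j -> (i, j) \notin [:: (u, v); (v, u)] ->
    `|f (V i)| != `|f (V j)|) ->
  lonely_vector_property V.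
Proof.
move=> uv D0 fuv nz ne; exists (u, v) => -[i j] neq.
apply: (functional_not_proportional D0 fuv).
have [<-|ij] := eqVneq i j; first by rewrite functional_Dconfig_diag nz.
(* The reversed label is exempt in [ne] and needs its own argument. *)
have [[-> ->]|swap] := eqVneq (i, j) (v, u).
  exact: functional_Dconfig_swap.
have := ne i j ij; rewrite functional_Dconfig_offdiag // !inE negb_or neq swap.
by case/(_ isT)/andP.
Qed.

End LonelyFunctional.

Theorem theorem4p6 (R : realFieldType) (n d : nat) (E : vectType R)
    (U : 'I_n -> 'rV[int]_d) (Ustar : 'I_n -> E)
    (hnd : ~ (n = 1%N /\ d = 1%N))
    (hU : config_rank (scalar_ext R U) = d)
    (hG : gale_dual (scalar_ext R U) Ustar) :
  lonely_vector_property Ustar <->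
  ((exists u : 'I_n, cosimple R (deletion U u)) \/
   (exists u v : 'I_n, u != v /\
      (cosimple R (pos_diagonal U u v) \/
       cosimple R (neg_diagonal U u v)))).
Proof.
have [_ _ dualdep] := hG.
(* Zero is proportional to the element at any other label. A single label is lonely vacuously, so
   [n = 1] must be settled by duality. *)
have lonely_neq0 p :
    (forall q, q != p -> ~ proportional (Dconfig Ustar p) (Dconfig Ustar q)) ->
    Dconfig Ustar p != 0.
  case: (leqP n 1) => [n1|n1] Dp; last first.
    pose q : 'I_n * 'I_n := (Ordinal n1, Ordinal (ltnW n1)).
    have [q' q'p] : exists q', q' != p.
      have [<-|] := eqVneq q p; last by exists q.
      by exists (q.1, q.1); rewrite xpair_eqE.
    by apply/eqP => D0; case: (Dp _ q'p); left; exists 0; rewrite scale0r.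
  (* The excluded case leaves n = 1 and d = 0, where U = 0 and so its dual
     is a nonzero vector. *)
  have d1 : (d <= 1)%N.
    by rewrite -hU (leq_trans (dim_span _)) // size_image card_ord.
  have n0 := leq_ltn_trans (leq0n _) (ltn_ord p.1).
  have nE : n = 1%N by apply/eqP; rewrite eqn_leq n1.
  have d0 : d = 0%N.
    apply/eqP; rewrite eqn0Ngt; apply/negP => d0; apply: hnd; split=> //.
    by apply/eqP; rewrite eqn_leq d1.
  have all_p1 i : i = p.1.
    apply: val_inj; case: i p.1 => [i ilt] [j jlt] /=; move: ilt jlt.
    by rewrite nE !ltnS !leqn0 => /eqP -> /eqP ->.
  rewrite [p]surjective_pairing (all_p1 p.2) Dconfig_diag.
  rewrite -scaler_nat scaler_eq0 pnatr_eq0 /=.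
  apply/negP => /eqP Vp.
  (* With a zero dual vector, the coefficient 1 would be a dependence, hence the value of a
     functional on [U]. *)
  have [g /(_ p.1)] : functional_values (scalar_ext R U) (fun=> 1).
    by apply/dualdep; rewrite /dependence big1 // => i _; rewrite (all_p1 i) Vp scaler0.
  have -> : scalar_ext R U p.1 = 0.
    by apply/rowP => k; have := ltn_ord k; rewrite [X in (_ < X)%N]d0.
  by rewrite linear0 => /eqP; rewrite oner_eq0.
(* The two diagonals are the cases [e = 1] and [e = -1]. *)
have posN u v : scalar_ext R (pos_diagonal U u v) None =
    scalar_ext R U u + 1 *: scalar_ext R U v.
  by rewrite scale1r; apply/rowP => k; rewrite !mxE intrD.
have negN u v : scalar_ext R (neg_diagonal U u v) None =
    scalar_ext R U u + -1 *: scalar_ext R U v.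
  by rewrite scaleN1r; apply/rowP => k; rewrite !mxE intrB.
have sqrN1 : -1 * -1 = 1 :> R by rewrite mulrNN mulr1.
have posDP u v uv := diagonal_cosimpleP hU hG uv (mulr1 1) (fun=> erefl) (posN u v).
have negDP u v uv := diagonal_cosimpleP hU hG uv sqrN1 (fun=> erefl) (negN u v).
split.
  case=> -[u v] Dp; have D0 := lonely_neq0 _ Dp.
  have [f fp fq] := not_proportional_functional Dp.
  have [uv|uv] := eqVneq u v.
    rewrite -uv in D0 fp fq; left; exists u; apply/(deletion_cosimpleP hU hG).
    split; first by apply: contraNneq D0 => Vu; rewrite Dconfig_diag Vu mul0rn.
    exists f; split=> [|i iu|i j iu ju ij].
    - by apply/eqP/negPn; rewrite -functional_Dconfig_diag fp eqxx.
    - by rewrite -functional_Dconfig_diag fq // xpair_eqE negb_and iu.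
    - by rewrite functional_Dconfig_offdiag // !fq // xpair_eqE negb_and ?iu ?ju.
  have nz i : f (Ustar i) != 0.
    rewrite -functional_Dconfig_diag fq // xpair_eqE.
    by apply: contra uv => /andP[/eqP <- /eqP <-].
  have ne i j : i != j -> (i, j) \notin [:: (u, v); (v, u)] ->
      `|f (Ustar i)| != `|f (Ustar j)|.
    move=> ij; rewrite !inE negb_or => /andP[n1 n2].
    by rewrite functional_Dconfig_offdiag // !fq // xpair_eqE andbC -xpair_eqE.
  right; exists u, v; split=> //.
  (* Signs are exchanged by duality: a lonely sum gives a negative diagonal, a lonely difference a
     positive one. *)
  have [lt_uv|lt_vu|/val_inj/eqP] := ltngtP u v; last by rewrite (negPf uv).
    rewrite Dconfig_lt // in D0 fp; right; apply/negDP => //.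
    rewrite scaleN1r opprK; split=> //; exists f; split=> //.
    by move: fp; rewrite linearD /=; lra.
  rewrite Dconfig_gt // in D0 fp; left; apply/posDP => //.
  rewrite scale1r; split=> //; exists f; split=> //.
  by move: fp; rewrite linearB /=; lra.
case=> [[u /(deletion_cosimpleP hU hG)[Vu [f [fu nz ne]]]]|[u [v [uv]]]].
  exact: lonely_deletion Vu fu nz ne.
have vu : v != u by rewrite eq_sym.
(* The sum or difference in question may be labelled [(v, u)] instead of [(u, v)], according to the
   order of the labels. *)
have sym (f : {scalar E}) :
  (forall i j : 'I_n, i != j -> (i, j) \notin [:: (u, v); (v, u)] ->
     `|f (Ustar i)| != `|f (Ustar j)|) ->
  forall i j, i != j -> (i, j) \notin [:: (v, u); (u, v)] ->
     `|f (Ustar i)| != `|f (Ustar j)|.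
  by move=> ne i j ij; rewrite !inE orbC => nij; apply: ne => //; rewrite !inE.
case=> [/(posDP _ _ uv)|/(negDP _ _ uv)].
  rewrite scale1r => -[D0 [f [fvu nz ne]]].
  have [lt_uv|lt_vu|/val_inj/eqP] := ltngtP u v; last by rewrite (negPf uv).
    apply: (lonely_diagonal vu _ _ nz (sym _ ne)); rewrite Dconfig_gt //.
      by rewrite -opprB oppr_eq0.
    by rewrite linearB /= fvu; lra.
  apply: (lonely_diagonal uv _ _ nz ne); rewrite Dconfig_gt //.
  by rewrite linearB /= fvu; lra.
rewrite scaleN1r opprK => -[D0 [f [fvu nz ne]]].
have [lt_uv|lt_vu|/val_inj/eqP] := ltngtP u v; last by rewrite (negPf uv).
  apply: (lonely_diagonal uv _ _ nz ne); rewrite Dconfig_lt //.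
  by rewrite linearD /= fvu; lra.
apply: (lonely_diagonal vu _ _ nz (sym _ ne)); rewrite Dconfig_lt ?[Ustar v + _]addrC //.
by rewrite linearD /= fvu; lra.
Qed.
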